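(* Let $S$ be an $n$-dimensional simplex in Euclidean $n$-space $\mathbb{R}^n$ with vertices $s_0=0,s_1,\dots,s_n$. Let $H$ be a hyperplane through $s_0=0$ with unit normal vector $u$ such that $s_1,\dots,s_n$ lie in the half-space $H^+=\{x:\langle u,x\rangle>0\}$, and let $S^H$ be the image of $S$ under reflection in $H$. Let $F_{i_1},\dots,F_{i_k}$ be the facets of the upper side of $S$ with respect to $H$, with respective outward unit normals $u_{i_1},\dots,u_{i_k}$, and let $s=\sum_{i=0}^n s_i$. Then $$\frac{1}{\mathrm{Vol}_n(S)}\,\mathrm{Vol}(\mathrm{conv}(S\cup S^H))=2n\sum_{l=1}^{k}\frac{\langle u_{i_l},u\rangle\,\langle u,s-s_{i_l}\rangle}{|\langle u_{i_l},(n+1)s_{i_l}-s\rangle|}.$$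
   Context: $\mathrm{Vol}=\mathrm{Vol}_n$ is $n$-dimensional volume, $\mathrm{conv}$ is the convex hull, and $\langle\cdot,\cdot\rangle$ is the Euclidean inner product. For $0\le i\le n$, $F_i$ denotes the facet of $S$ opposite to the vertex $s_i$ and $u_i$ its outward unit normal. The upper side of $S$ (with respect to $H$, imagined horizontal with $H^+$ above it) is the collection of those facets at which lines orthogonal to $H$, coming from far away in $H^+$, first meet $S$ (at relative interior points of the facet); equivalently, $F_i$ belongs to the upper side if and only if $\langle u_i,u\rangle>0$. *)

(* Defs.v *)
From HB Require Import structures.
From mathcomp Require Import all_boot all_order all_algebra.
From mathcomp Require Import all_classical all_reals all_analysis.

Set Implicit Arguments.
Unset Strict Implicit.
Unset Printing Implicit Defensive.

Import Order.TTheory GRing.Theory Num.Theory.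
Import numFieldNormedType.Exports.

Local Open Scope classical_set_scope.
Local Open Scope ring_scope.

Section lebesgue_tuple.
Variable R : realType.
Local Open Scope ereal_scope.
Local Notation RR := (measurableTypeR R).

Definition tuple_cons (n : nat) (p : RR * n.-tuple RR) : n.+1.-tuple RR :=
  [tuple of p.1 :: p.2].

Lemma measurable_tuple_cons (n : nat) :
  measurable_fun [set: RR * n.-tuple RR] (@tuple_cons n).
Proof. exact: measurable_cons. Qed.

Section step.
Variables (n : nat) (m : {sigma_finite_measure set (n.-tuple RR) -> \bar R}).

(* The product of the Lebesgue measure on R and of m, transported to tuples. *)
Definition lebesgue_cons : set (n.+1.-tuple RR) -> \bar R :=
  pushforward (@lebesgue_measure R \x m) (@tuple_cons n).

Let lebesgue_cons0 : lebesgue_cons set0 = 0.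
Proof. by rewrite /lebesgue_cons /pushforward preimage_set0 measure0. Qed.

Let lebesgue_cons_ge0 A : 0 <= lebesgue_cons A.
Proof. exact: (@measure_ge0 _ _ _ (@lebesgue_measure R \x m)). Qed.

Let lebesgue_cons_sigma_additive : semi_sigma_additive lebesgue_cons.
Proof.
move=> F mF tF mUF; rewrite /lebesgue_cons /pushforward preimage_bigcup.
have mf := @measurable_tuple_cons n.
apply: (@measure_semi_sigma_additive _ _ _ (@lebesgue_measure R \x m)).
- by move=> k; rewrite -[X in measurable X]setTI; exact: mf.
- apply/trivIsetP => /= i j _ _ ij; rewrite -preimage_setI.
  by move/trivIsetP : tF => /(_ _ _ _ _ ij) ->//; rewrite preimage_set0.
- by rewrite -preimage_bigcup -[X in measurable X]setTI; exact: mf.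
Qed.

HB.instance Definition _ := isMeasure.Build _ _ _ lebesgue_cons
  lebesgue_cons0 lebesgue_cons_ge0 lebesgue_cons_sigma_additive.

Lemma measurable_cons_rect (X : set RR) (Y : set (n.-tuple RR)) :
  measurable X -> measurable Y ->
  measurable [set t : n.+1.-tuple RR | X (thead t) /\ Y [tuple of behead t]].
Proof.
move=> mX mY; apply: measurableI.
  by have := @measurable_tnth _ RR n.+1 ord0 measurableT _ mX; rewrite setTI.
by have := @measurable_behead _ RR n measurableT _ mY; rewrite setTI.
Qed.

Lemma lebesgue_cons_rect (X : set RR) (Y : set (n.-tuple RR)) :
  measurable X -> measurable Y ->
  lebesgue_cons [set t | X (thead t) /\ Y [tuple of behead t]] =
  lebesgue_measure X * m Y.
Proof.
move=> mX mY; rewrite -product_measure1E// /lebesgue_cons /pushforward.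
congr (_ _); apply/seteqP; split=> -[x y] /=; rewrite theadE => -[Xx Yy].
- by split=> //=; suff <- : [tuple of behead (tuple_cons (x, y))] = y by [];
    exact/val_inj.
- by split=> //=; suff -> : [tuple of behead (tuple_cons (x, y))] = y by [];
    exact/val_inj.
Qed.

Let lebesgue_cons_sigma_finite : sigma_finite setT lebesgue_cons.
Proof.
have /sigma_finiteP[F [TF ndF Foo]] := sigma_finiteT (@lebesgue_measure R).
have /sigma_finiteP[G [TG ndG Goo]] := sigma_finiteT m.
exists (fun k => [set t | F k (thead t) /\ G k [tuple of behead t]]).
  apply/esym; rewrite -subTset => t _.
  have [i _ Fi] : (\bigcup_i F i) (thead t) by rewrite -TF.
  have [j _ Gj] : (\bigcup_i G i) [tuple of behead t] by rewrite -TG.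
  exists (maxn i j) => //; split.
    by move: Fi; exact/subsetPset/ndF/leq_maxl.
  by move: Gj; exact/subsetPset/ndG/leq_maxr.
move=> k; have [mF Fk] := Foo k; have [mG Gk] := Goo k.
split; first exact: measurable_cons_rect.
by rewrite lebesgue_cons_rect// lte_mul_pinfty// ge0_fin_numE.
Qed.

HB.instance Definition _ := Measure_isSigmaFinite.Build _ _ _
  lebesgue_cons lebesgue_cons_sigma_finite.

End step.

(* The n-fold product of the Lebesgue measure on R, on the product
   sigma-algebra, i.e. on the Borel sets of R^n. *)
Fixpoint lebesgue_tuple (n : nat) :
    {sigma_finite_measure set (n.-tuple RR) -> \bar R} :=
  match n return {sigma_finite_measure set (n.-tuple RR) -> \bar R} with
  | 0 => \d_([tuple] : 0.-tuple RR)
  | n'.+1 => lebesgue_cons (lebesgue_tuple n')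
  end.

Lemma lebesgue_tuple_box (n : nat) (a b : 'I_n -> R) :
  (forall i, (a i <= b i)%R) ->
  lebesgue_tuple n [set t | forall i, `[a i, b i]%classic (tnth t i)] =
  (\prod_(i < n) (b i - a i))%:E.
Proof.
elim: n a b => [|n IH] a b ab /=.
  by rewrite big_ord0 diracE mem_set// => -[].
set Y := [set t : n.-tuple RR |
  forall i, `[a (lift ord0 i), b (lift ord0 i)]%classic (tnth t i)].
have mY : measurable Y.
  have -> : Y = \bigcap_(i in [set: 'I_n])
      ((@tnth n RR)^~ i @^-1` `[a (lift ord0 i), b (lift ord0 i)]).
    by apply/seteqP; split => [t H i _|t H i]; exact: H.
  apply: fin_bigcap_measurable => //.
  by move=> i _; rewrite -[X in measurable X]setTI; apply: measurable_tnth.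
have -> : [set t : n.+1.-tuple RR | forall i, `[a i, b i]%classic (tnth t i)] =
   [set t | `[a ord0, b ord0]%classic (thead t) /\ Y [tuple of behead t]].
  apply/seteqP; split => t /=.
    move=> H; split; first exact: H.
    by move=> i; have := H (lift ord0 i); rewrite [in X in X -> _](tuple_eta t) tnthS.
  move=> [H0 H] i; case: (unliftP ord0 i) => [j ->|-> //].
  by have := H j; rewrite [in X in _ -> X](tuple_eta t) tnthS.
rewrite lebesgue_cons_rect//.
rewrite (IH (fun i => a (lift ord0 i)) (fun i => b (lift ord0 i))) //.
rewrite lebesgue_measure_itv /= lte_fin big_ord_recl EFinM.
have := ab ord0; rewrite le_eqVlt => /orP[/eqP ->|->]; last by rewrite EFinB.
by rewrite ltxx subrr !mul0e.
Qed.

End lebesgue_tuple.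

Section geometry.
Variables (R : realType) (n : nat).
Implicit Types (u v x y p : 'rV[R]_n) (A S F : set 'rV[R]_n).

(* Meaningful when A is a Borel set, e.g. compact. *)
Definition volume A : \bar R :=
  lebesgue_tuple R n [set t | A (\row_i tnth t i)].

Definition dot u v : R := (u *m v^T) 0 0.

Definition conv_hull A : set 'rV[R]_n := smallest (@convex_set R 'rV[R]_n) A.

Definition affine_set A : Prop :=
  forall x y (t : R), A x -> A y -> A ((1 - t) *: x + t *: y).

Definition affine_hull A : set 'rV[R]_n := smallest affine_set A.

(* The interior of A relative to its affine hull. *)
Definition relint A : set 'rV[R]_n :=
  [set x | A x /\ within (affine_hull A) (nbhs x) A].

(* Orthogonal reflection in the hyperplane through 0 with unit normal u. *)
Definition reflection u x : 'rV[R]_n := x - (2 * dot u x) *: u.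

Definition affinely_independent (m : nat) (s : 'I_m -> 'rV[R]_n) : Prop :=
  forall c : 'I_m -> R,
    \sum_i c i = 0 -> \sum_i c i *: s i = 0 -> forall i, c i = 0.

Definition simplex (m : nat) (s : 'I_m -> 'rV[R]_n) : set 'rV[R]_n :=
  conv_hull (range s).

(* The facet opposite to the vertex s i. *)
Definition facet (m : nat) (s : 'I_m -> 'rV[R]_n) (i : 'I_m) : set 'rV[R]_n :=
  conv_hull (s @` [set j | j != i]).

(* v is a unit vector normal to F, and S lies on the side of the hyperplane
   through F away from which v points. *)
Definition outward_unit_normal S F v : Prop :=
  [/\ dot v v = 1,
      forall x y, F x -> F y -> dot v (x - y) = 0
    & forall x y, S x -> F y -> dot v (x - y) <= 0].

(* p is where the line through p in direction u, followed from far away on the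
   side to which u points, first meets S. *)
Definition first_meets u S p : Prop :=
  S p /\ forall t : R, 0 < t -> ~ S (p + t *: u).

Definition upper_side (m : nat) (s : 'I_m -> 'rV[R]_n) u : set (set 'rV[R]_n) :=
  [set F | exists i, F = facet s i /\
     exists p, relint F p /\ first_meets u (simplex s) p].

End geometry.

(* Main.v *)
Require Import Defs.
From HB Require Import structures.
From mathcomp Require Import all_boot all_order all_algebra.
From mathcomp Require Import all_classical all_reals all_analysis.
From mathcomp Require Import measurable_realfun.
From mathcomp Require Import ring lra.

Set Implicit Arguments.
Unset Strict Implicit.
Unset Printing Implicit Defensive.

Import Order.TTheory GRing.Theory Num.Theory.
Import numFieldNormedType.Exports.

Local Open Scope classical_set_scope.
Local Open Scope ring_scope.

(** Let h = <u, .> be the height above H and let the slope a_i be the speed of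
    the i-th barycentric coordinate along u. The slopes sum to 0, and the i-th
    facet belongs to the upper side exactly when a_i < 0 ([upper_side_facet]).

    The convex hull of the simplex S and of its mirror image is the union, over
    the points z of S, of the vertical segment of length 2 h(z) hanging from z
    ([conv_hull_reflection]). Segments hanging from the upper facets suffice,
    since rising inside S ends on one of these. On a facet h(z) is the sum of
    z_k h(s_k), for barycentric coordinates z_k; so the prism below an upper
    facet F_i is a stack of layers, of thickness 2 z_k h(s_k), one for each
    vertex s_k of F_i. Up to a vertical shear, the k-th layer is the simplex
    with base F_i and apex s_k - 2 h(s_k) u. It is therefore an affine image of
    S, of volume 2 h(s_k) (- a_i) Vol(S) ([volume_piece]). Distinct layers
    overlap inside hyperplanes ([volume_pieceI]), which are null
    ([volume_hyperplane]), and altogether cover the hull ([double_prismE]).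
    Hence the ratio of volumes is the sum of 2 (- a_i) h(s_k) over the upper
    facets F_i and their vertices s_k ([volume_double_prism]). Finally the
    outward unit normal of F_i has inner product - a d_i with a vector along
    which the i-th barycentric coordinate has speed a, where d_i is the distance
    from s_i to F_i ([normal_slope]); so <u_i, u> = - a_i d_i and
    |<u_i, (n + 1) s_i - s>| = n d_i, which turns this sum into the stated one.

    All volumes are compared by affine changes of variables
    ([volume_affine_preimage]), obtained from Fubini's theorem by induction on
    the dimension. *)

(** * Affine maps of the line *)

Section affine_line.
Variable R : realType.
Local Notation RR := (measurableTypeR R).
Local Notation leb := (@lebesgue_measure R).

Definition line_map (a e : R) (x : RR) : RR := (x : R) * a + e.

Lemma measurable_line_map a e : measurable_fun [set: RR] (line_map a e).
Proof.
apply: (@measurable_funD _ RR R _ (fun x : RR => (x : R) * a) (fun=> e)) => //.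
exact: (@measurable_funM _ RR R _ id (fun=> a)).
Qed.

(** Stated with a preimage, like every change of variables below: both sides
    are then measures of the set, and measures agreeing on intervals agree. *)
Lemma lebesgue_measure_affine (a e : R) (A : set RR) : a != 0 -> measurable A ->
  (`|a|%:E * leb (line_map a e @^-1` A))%E = leb A.
Proof.
move=> a0 mA.
pose r : {nonneg R} := NngNum (normr_ge0 a).
have mf := @measurable_line_map a e.
pose mu1 := measure_function_pushforward__canonical__measure_function_Measure leb mf.
pose mu2 := measure_function_mscale__canonical__measure_function_Measure r mu1.
symmetry; apply: (@lebesgue_measure_unique _ mu2) => // X.
move=> [[p q] /= pq <-].
rewrite /mu2 /= /mscale /= /pushforward.
have [a_lt0|a_gt0] : a < 0 \/ 0 < a by move: a0; rewrite neq_lt => /orP[]; [left|right].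
  have -> : line_map a e @^-1` `]p, q] = `[(q - e) / a, (p - e) / a[%classic.
    apply/seteqP; split => x; rewrite /line_map /= !in_itv /=.
      move=> /andP[h1 h2].
      by rewrite ler_ndivrMr // ltr_ndivlMr //; apply/andP; split; lra.
    rewrite ler_ndivrMr // ltr_ndivlMr // => /andP[h1 h2].
    by apply/andP; split; lra.
  rewrite !lebesgue_measure_itv /= !lte_fin ltr_nM2r ?invr_lt0 // ltrD2r.
  case: ifP => _; last by rewrite mule0.
  by rewrite -!EFinB -EFinM ltr0_norm //; congr (_%:E); field; rewrite lt_eqF.
have -> : line_map a e @^-1` `]p, q] = `](p - e) / a, (q - e) / a]%classic.
  apply/seteqP; split => x; rewrite /line_map /= !in_itv /=.
    move=> /andP[h1 h2].
    by rewrite ltr_pdivrMr // ler_pdivlMr //; apply/andP; split; lra.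
  rewrite ltr_pdivrMr // ler_pdivlMr // => /andP[h1 h2].
  by apply/andP; split; lra.
rewrite !lebesgue_measure_itv /= !lte_fin ltr_pM2r ?invr_gt0 // ltrD2r.
case: ifP => _; last by rewrite mule0.
by rewrite -!EFinB -EFinM gtr0_norm //; congr (_%:E); field; rewrite gt_eqF.
Qed.

End affine_line.

(** * Borel sets of row vectors and Fubini's formulas *)

Section borel_sets.
Variable R : realType.
Local Notation RR := (measurableTypeR R).

Definition row_of_tuple n (t : n.-tuple RR) : 'rV[R]_n := \row_i tnth t i.

Definition tuple_of_row n (x : 'rV[R]_n) : n.-tuple RR :=
  [tuple (x 0 i : RR) | i < n].

Lemma tuple_of_rowK n : cancel (@tuple_of_row n) (@row_of_tuple n).
Proof. by move=> x; apply/rowP => i; rewrite mxE tnth_mktuple. Qed.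

Definition borel n (A : set 'rV[R]_n) : Prop :=
  measurable (@row_of_tuple n @^-1` A).

Definition affine_map m n (M : 'M[R]_(m, n)) (d : 'rV[R]_n) (x : 'rV[R]_m) :=
  x *m M + d.

Lemma measurable_fun_row_linear n (c : 'I_n -> R) (e : R) :
  measurable_fun [set: n.-tuple RR] (fun t => \sum_i (tnth t i : R) * c i + e : RR).
Proof.
apply: (@measurable_funD _ _ R _
  (fun t : n.-tuple RR => \sum_i (tnth t i : R) * c i) (fun=> e)) => //.
apply: (@measurable_sum _ _ R _ _ _ (fun i (t : n.-tuple RR) => (tnth t i : R) * c i)) => i.
apply: (@measurable_funM _ _ R _ (fun t : n.-tuple RR => (tnth t i : R)) (fun=> c i)) => //.
exact: measurable_tnth.
Qed.

Lemma borel_affine_map m n (M : 'M[R]_(m, n)) d (A : set 'rV[R]_n) :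
  borel A -> borel (affine_map M d @^-1` A).
Proof.
move=> bA; rewrite /borel.
pose g t := tuple_of_row (affine_map M d (row_of_tuple t)).
have mg : measurable_fun [set: m.-tuple RR] g.
  apply/measurable_fun_tnthP => i.
  apply: eq_measurable_fun (measurable_fun_row_linear (M^~ i) (d 0 i)) => t _.
  rewrite /g /= tnth_mktuple /affine_map !mxE.
  by under [in RHS]eq_bigr do rewrite mxE.
have -> : @row_of_tuple m @^-1` (affine_map M d @^-1` A) =
    setT `&` g @^-1` (@row_of_tuple n @^-1` A).
  by rewrite setTI; apply/seteqP; split => t; rewrite /g /= tuple_of_rowK.
exact: mg.
Qed.

Lemma borel_halfspace n (c : 'cV[R]_n) (e : R) :
  borel [set x : 'rV_n | 0 <= (x *m c) 0 0 + e].
Proof.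
have := measurable_fun_row_linear (c^~ 0) e.
move=> /(_ measurableT `[0, +oo[%classic (measurable_itv _)).
rewrite setTI /borel; congr measurable; apply/seteqP; split => t /=.
  rewrite in_itv /= andbT !mxE.
  by under [in X in _ -> is_true (_ <= X + _)]eq_bigr do rewrite mxE.
rewrite in_itv /= andbT !mxE.
by under [in X in is_true (_ <= X + _) -> _]eq_bigr do rewrite mxE.
Qed.

Lemma row_of_tuple_cons n (x : RR) (y : n.-tuple RR) :
  row_of_tuple (tuple_cons (x, y)) = row_mx (x : R)%:M (row_of_tuple y) :> 'rV_(1 + n).
Proof.
apply/rowP => i; case: (@split_ordP 1 n i) => j ->.
  rewrite row_mxEl ord1 [LHS]mxE [RHS]mxE (_ : lshift n 0 = ord0) //.
  exact: val_inj.
rewrite row_mxEr [LHS]mxE [RHS]mxE (_ : rshift 1 j = lift ord0 j) ?tnthS //.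
exact: val_inj.
Qed.

End borel_sets.

(** Slicing R^(1 + n) in either order; both orders are needed, since a shear
    of the first coordinate and a map of the others preserve different
    families of slices. *)
Section fubini.
Variables (R : realType) (n : nat).
Local Notation RR := (measurableTypeR R).
Local Notation leb := (@lebesgue_measure R).
Local Open Scope ereal_scope.
Implicit Type A : set 'rV[R]_(1 + n).

Let cons_pre A : set (RR * n.-tuple RR) :=
  [set p | A (row_mx (p.1 : R)%:M (row_of_tuple p.2))].

Let measurable_cons_pre A : borel A -> measurable (cons_pre A).
Proof.
move=> mA.
have := @measurable_tuple_cons R n measurableT _ mA; rewrite setTI.
congr measurable; apply/seteqP; split => -[x y] /=;
by rewrite /cons_pre /= row_of_tuple_cons.
Qed.

Lemma volume_consE A : @volume R (1 + n) A = (leb \x lebesgue_tuple R n) (cons_pre A).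
Proof.
rewrite /volume /= /lebesgue_cons /pushforward; congr (_ _).
apply/seteqP; split => -[x y] /=; rewrite /cons_pre /=;
by have <- := row_of_tuple_cons x y.
Qed.

Lemma volume_integral_tail A :
  volume A = \int[leb]_x volume [set y : 'rV[R]_n | A (row_mx (x : R)%:M y)].
Proof.
rewrite volume_consE /product_measure1; apply: eq_integral => x _ /=.
rewrite /volume /=; congr (_ _); apply/seteqP.
by split => y; rewrite /xsection /= inE.
Qed.

Lemma measurable_volume_tail A : borel A ->
  measurable_fun [set: RR]
    (fun x : RR => volume [set y : 'rV[R]_n | A (row_mx (x : R)%:M y)]).
Proof.
move=> /measurable_cons_pre mA.
apply: eq_measurable_fun (measurable_fun_xsection (lebesgue_tuple R n) mA) => x _ /=.
rewrite /volume /=; congr (_ _); apply/seteqP.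
by split => y; rewrite /xsection /= inE.
Qed.

Lemma borel_tail A (x : R) : borel A -> borel [set y : 'rV[R]_n | A (row_mx x%:M y)].
Proof.
move=> /measurable_cons_pre mA; rewrite /borel.
have := measurable_xsection x mA.
by congr measurable; apply/seteqP; split => y; rewrite /xsection /= inE.
Qed.

Lemma volume_integral_head A : borel A ->
  volume A = \int[lebesgue_tuple R n]_y
    leb [set x : RR | A (row_mx (x : R)%:M (row_of_tuple y))].
Proof.
move=> /measurable_cons_pre mA.
rewrite volume_consE (@product_measure_unique _ _ _ _ _ leb (lebesgue_tuple R n) (leb \x^ lebesgue_tuple R n)) //.
  apply: eq_integral => y _ /=; congr (_ _); apply/seteqP.
  by split => x; rewrite /ysection /= inE.
by move=> *; exact: product_measure2E.
Qed.

Lemma measurable_volume_head A : borel A ->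
  measurable_fun [set: n.-tuple RR]
    (fun y => leb [set x : RR | A (row_mx (x : R)%:M (row_of_tuple y))]).
Proof.
move=> /measurable_cons_pre mA.
apply: eq_measurable_fun (measurable_fun_ysection leb mA) => y _ /=.
congr (_ _); apply/seteqP.
by split => x; rewrite /ysection /= inE.
Qed.

Lemma measurable_head A (y : n.-tuple RR) : borel A ->
  measurable [set x : RR | A (row_mx (x : R)%:M (row_of_tuple y))].
Proof.
move=> /measurable_cons_pre mA; have := measurable_ysection y mA.
by congr measurable; apply/seteqP; split => x; rewrite /ysection /= inE.
Qed.

End fubini.

(** * Affine change of variables *)

Section affine_change_of_variables.
Variable R : realType.
Local Notation RR := (measurableTypeR R).
Local Notation leb := (@lebesgue_measure R).

Definition affine_scaling n (M : 'M[R]_n) (d : 'rV[R]_n) : Prop :=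
  forall A, borel A ->
    (`|\det M|%:E * volume (affine_map M d @^-1` A) = volume A)%E.

Lemma affine_map_comp n (M N : 'M[R]_n) d e x :
  affine_map N e (affine_map M d x) = affine_map (M *m N) (d *m N + e) x.
Proof. by rewrite /affine_map mulmxDl mulmxA addrA. Qed.

Lemma affine_scaling_comp n (M N : 'M[R]_n) d e :
  affine_scaling M d -> affine_scaling N e ->
  affine_scaling (M *m N) (d *m N + e).
Proof.
move=> sM sN A bA; rewrite det_mulmx normrM mulrC EFinM -muleA.
have -> : affine_map (M *m N) (d *m N + e) @^-1` A =
    affine_map M d @^-1` (affine_map N e @^-1` A).
  by apply/seteqP; split => x /=; rewrite affine_map_comp.
by rewrite sM ?sN //; exact: borel_affine_map.
Qed.

Lemma affine_map_tail n (D : 'M[R]_n) (c d y : 'rV[R]_n) (x : 'M[R]_1) :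
  affine_map (block_mx 1%:M c 0 D) (row_mx 0 d) (row_mx x y) =
  row_mx x (affine_map D (x *m c + d) y).
Proof.
rewrite /affine_map mul_row_block mulmx1 mulmx0 addr0 add_row_mx addr0.
by congr row_mx; rewrite addrCA addrA addrAC.
Qed.

(** Such a map fixes the first coordinate and acts affinely, with linear part
    D, on each slice on which this coordinate is constant. *)
Lemma affine_scaling_tail n (D : 'M[R]_n) (c d : 'rV[R]_n) :
  (forall d', affine_scaling D d') ->
  @affine_scaling (1 + n) (block_mx 1%:M c 0 D) (row_mx 0 d).
Proof.
move=> sD A bA; rewrite det_ublock det1 mul1r.
rewrite !volume_integral_tail.
have mf := measurable_volume_tail
  (borel_affine_map (block_mx 1%:M c 0 D) (row_mx 0 d) bA).
rewrite -(ge0_integralZl _ measurableT mf) //.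
apply: eq_integral => x _.
rewrite -(sD ((x : R)%:M *m c + d) [set y | A (row_mx (x : R)%:M y)]); last first.
  exact: borel_tail.
congr (_ * volume _)%E; apply/seteqP; split => y /=; by rewrite affine_map_tail.
Qed.

Lemma affine_map_head n (a e x : R) (b : 'cV[R]_n) (y : 'rV[R]_n) :
  affine_map (block_mx a%:M 0 b 1%:M) (row_mx e%:M 0) (row_mx x%:M y) =
  row_mx (line_map a ((y *m b) 0 0 + e) x)%:M y.
Proof.
rewrite /affine_map mul_row_block mulmx1 mulmx0 add0r add_row_mx addr0.
congr row_mx; apply/rowP => i; rewrite ord1 /line_map -scalar_mxM !mxE eqxx /=.
by rewrite !mulr1n addrA.
Qed.

(** Such a map fixes the last n coordinates and acts on each line parallel to
    the first axis as an affine map of ratio a. *)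
Lemma affine_scaling_head n (a e : R) (b : 'cV[R]_n) : a != 0 ->
  @affine_scaling (1 + n) (block_mx a%:M 0 b 1%:M) (row_mx e%:M 0).
Proof.
move=> a0 A bA; rewrite det_lblock det1 mulr1 det_scalar1.
have bA' := borel_affine_map (block_mx a%:M 0 b 1%:M) (row_mx e%:M 0) bA.
rewrite !volume_integral_head // -(ge0_integralZl _ measurableT (measurable_volume_head bA')) //.
apply: eq_integral => y _.
have mA := measurable_head y bA.
rewrite -(lebesgue_measure_affine ((row_of_tuple y *m b) 0 0 + e) a0 mA).
by congr (_ * leb _)%E; apply/seteqP; split => x /=; rewrite affine_map_head.
Qed.

(** Induction on the dimension. When the top left entry a of M is nonzero, M is
    the product of a map of the first line and a map of the slices, by block
    elimination of a. Otherwise a shear adding to the first row a row whose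
    first entry is nonzero reduces to that case. *)
Lemma affine_scaling_unit n (M : 'M[R]_n) d : M \in unitmx -> affine_scaling M d.
Proof.
elim: n M d => [M d _ A bA|n IH].
  rewrite det_mx00 normr1 mul1e; congr volume.
  by apply/seteqP; split => x /=; rewrite (_ : affine_map M d x = x) // thinmx0 [RHS]thinmx0.
have head_neq0 : forall (M : 'M[R]_(1 + n)) d, M \in unitmx ->
    M 0 0 != 0 -> affine_scaling M d.
  move=> M d uM a0; set a := M 0 0 in a0.
  pose D := drsubmx M - dlsubmx M *m (a^-1 *: ursubmx M).
  pose c := a^-1 *: ursubmx M.
  have ulE : ulsubmx M = a%:M.
    apply/matrixP => i j; rewrite !ord1 !mxE eqxx mulr1n /a; congr (M _ _); exact: val_inj.
  have ME : M = block_mx a%:M 0 (dlsubmx M) 1%:M *m block_mx 1%:M c 0 D.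
    rewrite mulmx_block !mul0mx !mulmx0 !mulmx1 !mul1mx !addr0.
    rewrite -[LHS]submxK ulE; congr block_mx.
      by rewrite mul_scalar_mx scalerA mulfV // scale1r.
    by rewrite addrC subrK.
  have dE : d = row_mx (d 0 0)%:M 0 *m block_mx 1%:M c 0 D +
      row_mx 0 (rsubmx d - (d 0 0)%:M *m c).
    rewrite mul_row_block !mul0mx mulmx1 !addr0 add_row_mx addr0 addrC subrK.
    rewrite -[LHS]hsubmxK; congr row_mx.
    apply/rowP => i; rewrite !ord1 !mxE eqxx mulr1n; congr (d _ _); exact: val_inj.
  have uD : D \in unitmx.
    move: uM; rewrite ME !unitmxE det_mulmx det_lblock det_ublock !det1 !mul1r mulr1.
    by rewrite det_scalar1 unitrM => /andP[].
  rewrite {1}ME dE; apply: affine_scaling_comp.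
    exact: affine_scaling_head.
  by apply: affine_scaling_tail => d'; exact: IH.
move=> M d uM.
have [a0|] := eqVneq (M 0 0) 0; last exact: head_neq0.
have [k bk] : exists k, M (rshift 1 k) 0 != 0.
  apply/existsP; apply: contraTT uM => /existsPn /= b0; apply/negP => uM.
  have Me0 : M *m (delta_mx 0 0 : 'cV_(1 + n)) = 0.
    rewrite -colE; apply/colP => i; rewrite !mxE.
    case: (@split_ordP 1 n i) => j ->; last by apply/eqP; rewrite -[_ == _]negbK b0.
    by rewrite ord1 (_ : lshift n 0 = 0) //; exact: val_inj.
  have := mulKmx uM (delta_mx 0 0 : 'cV_(1 + n)).
  rewrite Me0 mulmx0 => /matrixP/(_ 0 0); rewrite !mxE !eqxx => /eqP.
  by rewrite eq_sym oner_eq0.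
pose E := block_mx 1%:M (- delta_mx 0 k) 0 1%:M : 'M[R]_(1 + n).
pose E' := block_mx 1%:M (delta_mx 0 k) 0 1%:M : 'M[R]_(1 + n).
have EE' : E *m E' = 1%:M.
  rewrite mulmx_block !mul1mx !mulmx1 !mulmx0 !mul0mx !addr0 !add0r subrr.
  by rewrite -scalar_mx_block.
have -> : M = E *m (E' *m M) by rewrite mulmxA EE' mul1mx.
have -> : d = row_mx 0 0 *m (E' *m M) + d by rewrite row_mx0 mul0mx add0r.
apply: affine_scaling_comp.
  apply: affine_scaling_tail => d'; apply: IH; exact: unitmx1.
apply: head_neq0.
  by rewrite unitmx_mul uM andbT; have /mulmx1_unit[] := EE'.
rewrite -(@submxK _ 1 n 1 n M) (@mulmx_block _ 1 n 1 n 1 n) !mul1mx.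
rewrite (_ : 0 = lshift n 0 :> 'I_(1 + n)); last exact: val_inj.
rewrite block_mxEul mxE -rowE !mxE.
rewrite (_ : lshift n 0 = 0) ?a0 ?add0r //; exact: val_inj.
Qed.

Lemma volume_affine_preimage n (M : 'M[R]_n) d A : M \in unitmx -> borel A ->
  (`|\det M|%:E * volume (affine_map M d @^-1` A) = volume A)%E.
Proof. by move=> /affine_scaling_unit; exact. Qed.

End affine_change_of_variables.

(** * Affine forms and rank-one maps *)

Section affine_forms.
Variables (R : realType) (n : nat).
Implicit Types (u v w x y c : 'rV[R]_n) (phi : 'rV[R]_n -> R).

Lemma dotE u v : dot u v = \sum_i u 0 i * v 0 i.
Proof. by rewrite /dot mxE; apply: eq_bigr => i _; rewrite mxE. Qed.

Lemma dotC u v : dot u v = dot v u.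
Proof. by rewrite !dotE; apply: eq_bigr => i _; rewrite mulrC. Qed.

Lemma dotDr u v w : dot u (v + w) = dot u v + dot u w.
Proof. by rewrite /dot linearD mulmxDr mxE. Qed.

Lemma dotZr u a v : dot u (a *: v) = a * dot u v.
Proof. by rewrite /dot linearZ -scalemxAr mxE. Qed.

Lemma dotDl u v w : dot (u + v) w = dot u w + dot v w.
Proof. by rewrite /dot mulmxDl mxE. Qed.

Lemma dotZl u a v : dot (a *: u) v = a * dot u v.
Proof. by rewrite /dot -scalemxAl mxE. Qed.

Lemma dot0l v : dot 0 v = 0.
Proof. by rewrite /dot mul0mx mxE. Qed.

Lemma dot0r v : dot v 0 = 0.
Proof. by rewrite /dot trmx0 mulmx0 mxE. Qed.

Lemma dotBr u v w : dot u (v - w) = dot u v - dot u w.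
Proof. by rewrite dotDr -scaleN1r dotZr mulN1r. Qed.

Lemma dot_sumr u (I : Type) (r : seq I) (P : pred I) (F : I -> 'rV[R]_n) :
  dot u (\sum_(i <- r | P i) F i) = \sum_(i <- r | P i) dot u (F i).
Proof. by elim/big_rec2: _ => [|i x y _ <-]; rewrite ?dot0r ?dotDr. Qed.

(** The linear part of such a form is v |-> phi v - phi 0, which is how
    slopes are written below. *)
Definition affine_form phi := exists c e, forall x, phi x = dot c x + e.

Lemma affine_formD phi psi : affine_form phi -> affine_form psi ->
  affine_form (fun x => phi x + psi x).
Proof.
move=> [c [e phiE]] [c' [e' psiE]]; exists (c + c'), (e + e') => x.
by rewrite phiE psiE dotDl addrACA.
Qed.

Lemma affine_formZ a phi : affine_form phi -> affine_form (fun x => a * phi x).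
Proof.
by move=> [c [e phiE]]; exists (a *: c), (a * e) => x; rewrite phiE dotZl mulrDr.
Qed.

Lemma affine_formB phi psi : affine_form phi -> affine_form psi ->
  affine_form (fun x => phi x - psi x).
Proof.
move=> aphi /(affine_formZ (-1))/(affine_formD aphi) [c [e E]].
by exists c, e => x; rewrite -E mulN1r.
Qed.

Lemma affine_form_sum (I : Type) (r : seq I) (P : pred I) (F : I -> 'rV[R]_n -> R) :
  (forall i, affine_form (F i)) ->
  affine_form (fun x => \sum_(i <- r | P i) F i x).
Proof.
move=> aF; elim: r => [|i r IH].
  by exists 0, 0 => x; rewrite big_nil dot0l addr0.
case: (boolP (P i)) => Pi; last first.
  have [c [e E]] := IH; exists c, e => x; by rewrite big_cons (negPf Pi) E.
have [c [e E]] := affine_formD (aF i) IH; exists c, e => x.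
by rewrite big_cons Pi E.
Qed.

Lemma affine_form_shift phi x t v : affine_form phi ->
  phi (x + t *: v) = phi x + t * (phi v - phi 0).
Proof.
by move=> [c [e phiE]]; rewrite !phiE dotDr dotZr dot0r; ring.
Qed.

Lemma affine_form_convex phi x y t : affine_form phi ->
  phi ((1 - t) *: x + t *: y) = (1 - t) * phi x + t * phi y.
Proof. by move=> [c [e phiE]]; rewrite !phiE dotDr !dotZr; ring. Qed.

Lemma borel_affine_form phi : affine_form phi -> borel [set x | 0 <= phi x].
Proof.
move=> [c [e phiE]]; have := @borel_halfspace R n c^T e.
congr borel; apply/seteqP; split => x /=;
by rewrite phiE dotC.
Qed.

Definition rank_one phi w x := x + phi x *: w.

(** Both sides are the determinant of the block matrix (1, - w; c^T, 1),
    factored by eliminating either diagonal block. *)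
Lemma det_rank_one c w : \det (1%:M + c^T *m w) = 1 + dot c w.
Proof.
have lhs : \det (block_mx (1%:M : 'M[R]_1) (- w) c^T 1%:M) = \det (1%:M + c^T *m w).
  rewrite (_ : block_mx _ _ _ _ =
      block_mx 1%:M 0 c^T 1%:M *m block_mx 1%:M (- w) 0 (1%:M + c^T *m w)).
    by rewrite det_mulmx det_lblock det_ublock !det1 !mul1r.
  rewrite mulmx_block !mul1mx !mulmx1 !mul0mx !addr0 mulmxN addrCA.
  by rewrite addNr addr0.
rewrite -lhs (_ : block_mx _ _ _ _ =
    block_mx 1%:M (- w) 0 1%:M *m block_mx (1%:M + w *m c^T) 0 c^T 1%:M).
  rewrite det_mulmx det_lblock det_ublock !det1 !mul1r mulr1 det_mx11 mxE.
  by rewrite [X in X + _]mxE eqxx dotC.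
rewrite mulmx_block !mul1mx !mulmx1 !mul0mx !add0r mulNmx.
by rewrite addrK.
Qed.

Lemma rank_oneE phi w : affine_form phi ->
  exists M d, (forall x, rank_one phi w x = affine_map M d x) /\
    \det M = 1 + (phi w - phi 0).
Proof.
move=> [c [e phiE]]; exists (1%:M + c^T *m w), (e *: w); split; last first.
  by rewrite det_rank_one !phiE dot0r; congr (1 + _); ring.
move=> x; rewrite /rank_one /affine_map mulmxDr mulmx1 -addrA; congr (_ + _).
rewrite phiE scalerDl mulmxA; congr (_ + _).
rewrite -mul_scalar_mx; congr (_ *m _); apply/matrixP => i j; rewrite !ord1.
by rewrite mxE eqxx mulr1n dotC.
Qed.

Lemma borel_rank_one phi w A : affine_form phi -> borel A ->
  borel (rank_one phi w @^-1` A).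
Proof.
move=> /(rank_oneE w)[M [d [E _]]] bA.
have -> : rank_one phi w = affine_map M d by apply/funext.
exact: borel_affine_map.
Qed.

Lemma volume_rank_one phi w A : affine_form phi ->
  1 + (phi w - phi 0) != 0 -> borel A ->
  (`|1 + (phi w - phi 0)|%:E * volume (rank_one phi w @^-1` A) = volume A)%E.
Proof.
move=> /(rank_oneE w)[M [d [E detM]]] nz bA.
have -> : rank_one phi w = affine_map M d by apply/funext.
by rewrite -detM; apply: volume_affine_preimage; rewrite // unitmxE detM unitfE.
Qed.

(** The rank-one map of factor 2 along v fixes every point of the hyperplane
    phi = 0 and no other point is sent into it. Hence A is its own preimage, and
    twice its volume is its volume. *)
Lemma volume_hyperplane phi v A : affine_form phi -> phi v != phi 0 ->
  borel A -> A `<=` [set x | phi x = 0] -> (volume A < +oo)%E -> volume A = 0%E.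
Proof.
move=> aphi phiv bA sA Afin.
have nz : (1 + 1 : R) != 0 by rewrite (_ : 1 + 1 = 2%:R) // pnatr_eq0.
have d0 : phi v - phi 0 != 0 by rewrite subr_eq0.
(* With this normalization the rank-one map doubles phi. *)
pose w := (phi v - phi 0)^-1 *: v.
have wE : phi w - phi 0 = 1.
  have := @affine_form_shift phi 0 (phi v - phi 0)^-1 v aphi; rewrite add0r => ->.
  by rewrite addrAC subrr add0r mulVf.
have := @volume_rank_one phi w A aphi; rewrite wE => /(_ _ bA).
have -> : rank_one phi w @^-1` A = A.
  apply/seteqP; split => x /= Ax.
    have := sA _ Ax; rewrite /= /rank_one affine_form_shift // wE => phix.
    have phix0 : phi x = 0 by move: phix; clear; lra.
    by move: Ax; rewrite /rank_one phix0 scale0r addr0.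
  by rewrite /rank_one (sA _ Ax) scale0r addr0.
have V0 : (0 <= volume A)%E by exact: measure_ge0.
have /fineK <- : volume A \is a fin_num by rewrite ge0_fin_numE.
move=> /(_ nz); rewrite -EFinM => -[]; rewrite ger0_norm // => E.
by congr (_%:E); move: E; clear; lra.
Qed.

End affine_forms.

(** * Unions with null overlaps *)

Section almost_disjoint.
Local Open Scope ereal_scope.

Context d (T : measurableType d) (R : realType) (mu : {measure set T -> \bar R}).

Lemma measureU_almost_disjoint (A B : set T) :
  measurable A -> measurable B -> mu (A `&` B) = 0 ->
  mu (A `|` B) = mu A + mu B.
Proof.
move=> mA mB AB0.
have mBA : measurable (B `\` A) by exact: measurableD.
rewrite (_ : A `|` B = A `|` (B `\` A)); last first.
  by apply/seteqP; split => x /=; [have [|] := pselect (A x); tauto|tauto].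
rewrite measureU //; last first.
  by apply/seteqP; split => // x [? []].
by rewrite [in RHS](measureDI mu mB mA) setIC [X in _ = _ + (_ + X)]AB0 adde0.
Qed.

Lemma measure_bigsetU_almost_disjoint (I : eqType) (r : seq I) (P : pred I)
    (D : I -> set T) :
  uniq r -> (forall i, P i -> measurable (D i)) ->
  (forall i j, P i -> P j -> i != j -> mu (D i `&` D j) = 0) ->
  mu (\big[setU/set0]_(i <- r | P i) D i) = \sum_(i <- r | P i) mu (D i).
Proof.
move=> + mD D0.
have mU s : measurable (\big[setU/set0]_(j <- s | P j) D j).
  by elim/big_rec: _ => // j X Pj mX; apply: measurableU => //; exact: mD.
elim: r => [|i r IH] /=; first by rewrite !big_nil measure0.
move=> /andP[ir /IH {}IH]; rewrite !big_cons; case: ifP => // Pi.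
rewrite measureU_almost_disjoint ?IH //; first exact: mD.
elim: r ir {IH} => [|j r IH]; first by rewrite big_nil setI0 measure0.
rewrite inE negb_or => /andP[ij /IH {}IH]; rewrite big_cons; case: ifP => // Pj.
apply/eqP; rewrite eq_le measure_ge0 andbT setIUr.
apply: le_trans (measureU2 _ _ _) _.
- by apply: measurableI; exact: mD.
- by apply: measurableI => //; exact: mD.
by rewrite [X in (X + _ <= _)%E]D0 // [X in (_ + X <= _)%E]IH adde0.
Qed.

End almost_disjoint.

Section volume_union.
Variables (R : realType) (n : nat).
Local Open Scope ereal_scope.

Lemma le_volume (A B : set 'rV[R]_n) : borel A -> borel B -> A `<=` B ->
  volume A <= volume B.
Proof. by move=> bA bB AB; apply: le_measure; rewrite ?inE // => t; exact: AB. Qed.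

Lemma volume_bigcup_almost_disjoint (I : finType) (P : pred I)
    (D : I -> set 'rV[R]_n) :
  (forall i, P i -> borel (D i)) ->
  (forall i j, P i -> P j -> i != j -> volume (D i `&` D j) = 0) ->
  volume [set x | exists2 i, P i & D i x] = \sum_(i | P i) volume (D i).
Proof.
move=> bD D0; rewrite -measure_bigsetU_almost_disjoint ?index_enum_uniq //.
rewrite /volume; congr (_ _); apply/seteqP; split => t /=.
  by move=> [i Pi Di]; rewrite (bigD1 i) //=; left.
by elim/big_rec: _ => // i X Pi IH [Di|/IH //]; exists i.
Qed.

End volume_union.

(** * Convex hulls *)

Section convex_hulls.
Variables (R : realType) (n : nat).
Implicit Types (x y : 'rV[R]_n) (A C : set 'rV[R]_n).

Lemma convex_setP C : @convex_set R 'rV[R]_n C <->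
  forall x y (t : R), 0 <= t -> t <= 1 -> C x -> C y -> C ((1 - t) *: x + t *: y).
Proof.
split => [cC x y t t0 t1 Cx Cy|cC x y t].
  have := cC y x (Itv01 t0 t1); rewrite !inE => /(_ Cy Cx).
  by rewrite /conv /= addrC.
rewrite !inE => Cx Cy; rewrite /conv /= addrC.
exact: cC (ge0 t) (le1 t) Cy Cx.
Qed.

Lemma convex_conv_hull A : @convex_set R 'rV[R]_n (conv_hull A).
Proof.
apply/convex_setP => x y t t0 t1 Hx Hy C [cC AC].
have /convex_setP := cC; apply => //; [exact: Hx|exact: Hy].
Qed.

Lemma sub_conv_hull A : A `<=` conv_hull A.
Proof. by move=> x Ax C [_]; exact. Qed.

Lemma conv_hull_sub A C : @convex_set R 'rV[R]_n C -> A `<=` C -> conv_hull A `<=` C.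
Proof. by move=> cC AC x; apply; split. Qed.

(** The sum of the weights is not normalized to 1, so that the induction on
    the sequence goes through. *)
Lemma convex_set_sum C (I : eqType) (r : seq I) (c : I -> R) (p : I -> 'rV[R]_n) :
  @convex_set R 'rV[R]_n C -> (forall i, 0 <= c i) ->
  (forall i, c i != 0 -> C (p i)) -> 0 < \sum_(i <- r) c i ->
  C ((\sum_(i <- r) c i)^-1 *: \sum_(i <- r) c i *: p i).
Proof.
move=> /convex_setP cC c0 Cp; elim: r => [|i r IH]; first by rewrite big_nil ltxx.
rewrite !big_cons; set t := \sum_(j <- r) c j in IH *.
have t0 : 0 <= t by apply: sumr_ge0.
have [ci0|ci0] := eqVneq (c i) 0; first by rewrite ci0 scale0r !add0r.
have cip : 0 < c i by rewrite lt_neqAle eq_sym ci0 c0.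
move: t0; rewrite le_eqVlt => /predU1P[t0 _|t0 ct].
  have -> : \sum_(j <- r) c j *: p j = 0.
    have := esym t0; rewrite /t => /eqP; rewrite psumr_eq0 // => /allP ct0.
    by rewrite big_seq big1 // => j /ct0 /eqP ->; rewrite scale0r.
  by rewrite -t0 !addr0 scalerA mulVf // scale1r; exact: Cp.
have -> : (c i + t)^-1 *: (c i *: p i + \sum_(j <- r) c j *: p j) =
   (1 - t / (c i + t)) *: p i +
   (t / (c i + t)) *: (t^-1 *: (\sum_(j <- r) c j *: p j)).
  rewrite scalerDr !scalerA; congr (_ *: _ + _ *: _); field; rewrite ?gt_eqF //.
apply: cC; [| |exact: Cp|exact: IH].
  by rewrite divr_ge0 // ltW.
by rewrite ler_pdivrMr // mul1r lerDr ltW.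
Qed.

End convex_hulls.

Lemma affine_form_continuous (R : realType) n (phi : 'rV[R]_n -> R) :
  affine_form phi -> continuous phi.
Proof.
move=> [c [e phiE]] x; rewrite (_ : phi = (fun y => \sum_i c 0 i * y 0 i + e)); last first.
  by apply/funext => y; rewrite phiE dotE.
have lin : continuous (fun y : 'rV[R]_n => \sum_i c 0 i * y 0 i).
  apply: continuous_big => [|i _ y]; first exact: add_continuous.
  exact: cvgM (cvg_cst _) (@coord_continuous R 1 n 0 i y).
exact: cvgD (lin x) (cvg_cst _).
Qed.

Section boxes.
Variables (R : realType) (n : nat).

Definition box (a b : 'I_n -> R) : set 'rV[R]_n :=
  [set x : 'rV[R]_n | forall i, a i <= x 0 i <= b i].

Lemma volume_box a b : (forall i, a i <= b i) ->
  volume (box a b) = (\prod_(i < n) (b i - a i))%:E.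
Proof.
move=> /lebesgue_tuple_box <-; rewrite /volume; congr (_ _).
by apply/seteqP; split => t /= H i; have := H i; rewrite mxE in_itv.
Qed.

Lemma borel_box a b : borel (box a b).
Proof.
rewrite /borel (_ : _ @^-1` _ = \bigcap_(j in [set: 'I_n])
    ((@tnth n (measurableTypeR R))^~ j @^-1` `[a j, b j])); last first.
  by apply/seteqP; split => [t H i _|t H i]; have := H i; rewrite /= mxE in_itv; [|apply].
apply: fin_bigcap_measurable => // j _.
by rewrite -[X in measurable X]setTI; apply: measurable_tnth.
Qed.

End boxes.

(** * Barycentric coordinates *)

Section barycentric.
Variables (R : realType) (n : nat) (s : 'I_n.+1 -> 'rV[R]_n).
Hypothesis s_indep : affinely_independent s.
Implicit Types (x y v : 'rV[R]_n) (j k : 'I_n.+1).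

(** A vertex is lifted to height 1, so that affine independence of the points
    is linear independence of the rows. *)
Definition vertex_mx : 'M[R]_(n.+1, 1 + n) := \matrix_i row_mx 1%:M (s i).

Definition bary j x : R := (row_mx (1%:M : 'M[R]_1) x *m invmx (vertex_mx : 'M[R]_n.+1)) 0 j.

Lemma mul_vertex_mx (c : 'rV[R]_n.+1) :
  c *m vertex_mx = row_mx (\sum_j c 0 j)%:M (\sum_j c 0 j *: s j).
Proof.
rewrite mulmx_sum_row.
under eq_bigr do rewrite rowK scale_row_mx.
apply/rowP => k; case: (@split_ordP 1 n k) => l ->.
  rewrite row_mxEl summxE !ord1 mxE eqxx mulr1n; apply: eq_bigr => j _.
  by rewrite row_mxEl !mxE eqxx mulr1.
by rewrite row_mxEr !summxE; apply: eq_bigr => j _; rewrite row_mxEr.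
Qed.

Lemma vertex_mx_unit : (vertex_mx : 'M[R]_n.+1) \in unitmx.
Proof.
rewrite -row_free_unit -kermx_eq0; apply/rowV0P => c /sub_kermxP.
rewrite mul_vertex_mx => E.
have [c0 cs0] := @eq_row_mx _ 1 1 n _ _ _ _ (etrans E (esym (@row_mx0 _ 1 1 n))).
apply/rowP => j; rewrite mxE; apply: s_indep j => //.
by have := congr1 (fun M : 'M[R]_1 => M 0 0) c0; rewrite !mxE eqxx.
Qed.

Lemma row_mx_bary x :
  row_mx (\sum_j bary j x)%:M (\sum_j bary j x *: s j) = row_mx 1%:M x.
Proof.
rewrite -(mul_vertex_mx (row_mx (1%:M : 'M[R]_1) x *m invmx (vertex_mx : 'M[R]_n.+1))).
exact: (mulmxKV vertex_mx_unit (row_mx (1%:M : 'M[R]_1) x)).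
Qed.

Lemma sum_bary x : \sum_j bary j x = 1.
Proof.
have [/(congr1 (fun M : 'M[R]_1 => M 0 0)) + _] := eq_row_mx (row_mx_bary x).
by rewrite !mxE eqxx.
Qed.

Lemma sum_bary_vertex x : \sum_j bary j x *: s j = x.
Proof. by have [] := eq_row_mx (row_mx_bary x). Qed.

Lemma dot_bary v x : dot v x = \sum_j bary j x * dot v (s j).
Proof.
rewrite -{1}(sum_bary_vertex x) dot_sumr.
by apply: eq_bigr => j _; rewrite dotZr.
Qed.

Lemma bary_vertex j k : bary j (s k) = (j == k)%:R.
Proof.
rewrite /bary -(rowK (fun i => row_mx (1%:M : 'M[R]_1) (s i)) k) -row_mul.
by rewrite (mulmxV vertex_mx_unit) !mxE eq_sym.
Qed.

Lemma affine_form_bary j : affine_form (bary j).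
Proof.
pose N : 'M[R]_(1 + n, n.+1) := invmx (vertex_mx : 'M[R]_n.+1).
exists (col j (dsubmx N))^T, (usubmx N 0 j) => x.
rewrite /bary -/N -{1}(vsubmxK N) (@mul_row_col _ 1 1 n n.+1) mul1mx mxE addrC.
by congr (_ + _); rewrite dotC /dot trmxK [LHS]mxE [RHS]mxE; apply: eq_bigr => i _; rewrite [in RHS]mxE.
Qed.

(** The right-hand side is convex because barycentric coordinates are affine;
    conversely each of its points is the combination of vertices given by its
    own coordinates. *)
Lemma conv_hull_vertices (J : set 'I_n.+1) :
  conv_hull (s @` J) =
  [set x | (forall j, 0 <= bary j x) /\ (forall j, ~ J j -> bary j x = 0)].
Proof.
apply/seteqP; split.
  apply: conv_hull_sub.
    apply/convex_setP => x y t t0 t1 [x0 xJ] [y0 yJ]; split => j.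
      rewrite (affine_form_convex _ _ _ (affine_form_bary j)).
      by rewrite addr_ge0 ?mulr_ge0 // subr_ge0.
    move=> Jj; rewrite (affine_form_convex _ _ _ (affine_form_bary j)).
    by rewrite xJ ?yJ // !mulr0 addr0.
  move=> _ [k Jk <-]; split => j; rewrite bary_vertex ?ler0n // => Jj.
  by case: eqP => // jk; case: Jj; rewrite jk.
move=> x [x0 xJ].
have := @convex_set_sum _ _ _ _ (index_enum 'I_n.+1) (bary^~ x) s (@convex_conv_hull R n (s @` J)).
rewrite sum_bary invr1 scale1r sum_bary_vertex; apply => //.
move=> i bi; apply: sub_conv_hull; exists i => //.
by apply: contrapT => Ji; move: bi; rewrite xJ ?eqxx.
Qed.

Lemma simplexE : simplex s = [set x | forall j, 0 <= bary j x].
Proof.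
rewrite /simplex conv_hull_vertices.
by apply/seteqP; split => x /=; [case|split].
Qed.

Lemma facetE i : facet s i = [set x | (forall j, 0 <= bary j x) /\ bary i x = 0].
Proof.
rewrite /facet conv_hull_vertices; apply/seteqP; split => x /= [x0 xi]; split => //.
  by apply: xi; rewrite eqxx.
by move=> j /negP; rewrite negbK => /eqP ->.
Qed.

Lemma borel_simplex : borel (simplex s).
Proof.
rewrite simplexE /borel.
rewrite (_ : _ @^-1` _ = \bigcap_(j in [set: 'I_n.+1])
    (@row_of_tuple R n @^-1` [set x | 0 <= bary j x])); last first.
  by apply/seteqP; split => [t H j _|t H j]; exact: H.
apply: fin_bigcap_measurable => // j _.
exact: (borel_affine_form (affine_form_bary j)).
Qed.

Lemma sub_simplex_coord x (i : 'I_n) : simplex s x -> `|x 0 i| <= \sum_j `|s j 0 i|.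
Proof.
rewrite simplexE => x0; rewrite -{1}(sum_bary_vertex x) summxE.
apply: le_trans (ler_norm_sum _ _ _) _; apply: ler_sum => j _.
rewrite mxE normrM ger0_norm // ler_piMl //.
by rewrite -(sum_bary x) (bigD1 j) //= lerDl sumr_ge0.
Qed.

Lemma volume_simplex_lty : (volume (simplex s) < +oo)%E.
Proof.
pose C (i : 'I_n) : R := \sum_j `|s j 0 i|.
have : simplex s `<=` box (fun i => - C i) C.
  by move=> x Sx i; rewrite -ler_norml; exact: sub_simplex_coord.
move=> /(le_volume borel_simplex (borel_box _ _)) /le_lt_trans; apply.
rewrite volume_box ?ltry // => i.
have C0 : 0 <= C i by apply: sumr_ge0.
by rewrite (le_trans _ C0) // oppr_le0.
Qed.

(** All barycentric coordinates are positive at the centroid, hence on a small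
    box around it. *)
Lemma volume_simplex_gt0 : (0 < volume (simplex s))%E.
Proof.
pose g := n.+1%:R^-1 *: \sum_j s j.
have bg j : bary j g = n.+1%:R^-1.
  have [c [e E]] := affine_form_bary j.
  have N0 : n.+1%:R != 0 :> R by rewrite pnatr_eq0.
  apply: (mulfI N0); rewrite mulfV // E mulrDr dotZr mulrA mulfV // mul1r dot_sumr.
  transitivity (\sum_k bary j (s k)).
    under [RHS]eq_bigr do rewrite E.
    by rewrite big_split /= sumr_const card_ord mulr_natl.
  under eq_bigr do rewrite bary_vertex.
  by rewrite (bigD1 j) //= eqxx big1 ?addr0 // => k; rewrite eq_sym => /negPf ->.
have : \forall x \near g, forall j, 0 < bary j x.
  apply: (@filter_forall _ _ _ (nbhs (g : 'rV[R]_n)) _) => j.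
  have cont : continuous (bary j) by exact: affine_form_continuous (affine_form_bary j).
  apply: (cvgr_gt (bary j g)); first exact: (cont g).
  by rewrite bg invr_gt0 ltr0n.
move=> /nbhs_ballP[e /= e0 ge].
apply: (@lt_le_trans _ _ (volume (box (fun i => g 0 i - e / 2) (fun i => g 0 i + e / 2)))).
  rewrite volume_box; last by move=> i; lra.
  rewrite lte_fin prodr_gt0 // => i _; lra.
apply: le_volume; [exact: borel_box|exact: borel_simplex|].
move=> x xb; rewrite simplexE /= => j; apply/ltW/ge; split => // i k.
rewrite ord1 -ball_normE /= ltr_norml; have := xb k; lra.
Qed.

End barycentric.

(** * The convex hull of a simplex and its mirror image *)

Section double_prism.
Variables (R : realType) (n : nat) (s : 'I_n.+1 -> 'rV[R]_n) (u : 'rV[R]_n).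
Hypothesis s_indep : affinely_independent s.
Hypothesis s_0 : s ord0 = 0.
Hypothesis u_unit : dot u u = 1.
Hypothesis s_above : forall i, i != ord0 -> 0 < dot u (s i).
Implicit Types (x y z : 'rV[R]_n) (i j k : 'I_n.+1).

Local Notation bary := (bary s).
Local Notation h k := (dot u (s k)).

(** The speed of the j-th barycentric coordinate of a point moving with
    velocity u. *)
Definition slope j := bary j u - bary j 0.
Local Notation a := slope.

Let aff j := affine_form_bary s j.

Lemma bary_shift j x t : bary j (x + t *: u) = bary j x + t * a j.
Proof. exact: affine_form_shift. Qed.

Lemma vertex_height_ge0 k : 0 <= h k.
Proof. by have [->|/s_above/ltW //] := eqVneq k ord0; rewrite s_0 dot0r. Qed.

Lemma sum_slope : \sum_j a j = 0.
Proof. by rewrite sumrB !sum_bary // subrr. Qed.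

(** The height of a point moving with velocity u grows at speed <u, u> = 1. *)
Lemma sum_slope_height : \sum_j a j * h j = 1.
Proof.
rewrite -u_unit -[RHS]subr0 -{2}(dot0r u) !(dot_bary s_indep u) -sumrB.
by apply: eq_bigr => j _; rewrite mulrBl.
Qed.

Lemma simplex_height_ge0 z : simplex s z -> 0 <= dot u z.
Proof.
rewrite simplexE // (dot_bary s_indep u) => z0; apply: sumr_ge0 => j _.
by rewrite mulr_ge0 ?vertex_height_ge0.
Qed.

(** The vertical segments between the points of the simplex and their
    reflections. *)
Definition double_prism : set 'rV[R]_n := [set y | exists z t,
  [/\ simplex s z, 0 <= t, t <= 2 * dot u z & y = z - t *: u]].

(** The double prism is convex because the length 2 * dot u z of the segment
    below z is affine in z, and each of its segments joins a point of the
    simplex to the reflection of this point. *)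
Lemma conv_hull_reflection :
  conv_hull (simplex s `|` reflection u @` simplex s) = double_prism.
Proof.
apply/seteqP; split.
  apply: conv_hull_sub.
    apply/convex_setP => _ _ l l0 l1 [z [t [Sz t0 tz ->]]] [z' [t' [Sz' t'0 t'z ->]]].
    exists ((1 - l) *: z + l *: z'), ((1 - l) * t + l * t'); split.
    - by have /convex_setP := @convex_conv_hull R n (range s); apply.
    - by rewrite addr_ge0 ?mulr_ge0 // subr_ge0.
    - rewrite dotDr !dotZr.
      have : 0 <= (1 - l) * (2 * dot u z - t) by rewrite mulr_ge0 // subr_ge0.
      have : 0 <= l * (2 * dot u z' - t') by rewrite mulr_ge0 // subr_ge0.
      by lra.
    - by rewrite [X in _ = _ - X]scalerDl !scalerBr !scalerA opprD addrACA.
  move=> x [Sx|[z Sz <-]]; last first.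
    exists z, (2 * dot u z); split => //.
    by rewrite mulr_ge0 // simplex_height_ge0.
  exists x, 0; split => //; last by rewrite scale0r subr0.
  by rewrite mulr_ge0 // simplex_height_ge0.
move=> _ [z [t [Sz t0 tz ->]]].
have Kz : conv_hull (simplex s `|` reflection u @` simplex s) z.
  by apply: sub_conv_hull; left.
have Krz : conv_hull (simplex s `|` reflection u @` simplex s) (reflection u z).
  by apply: sub_conv_hull; right; exists z.
have [z0|z0] := eqVneq (dot u z) 0.
  have -> : t = 0 by move: t0 tz; rewrite z0; lra.
  by rewrite scale0r subr0.
have zp : 0 < dot u z by rewrite lt_neqAle eq_sym z0 simplex_height_ge0.
have z2 : 0 < 2 * dot u z by rewrite mulr_gt0.
rewrite (_ : z - t *: u = (1 - t / (2 * dot u z)) *: z +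
    (t / (2 * dot u z)) *: reflection u z).
  have /convex_setP := @convex_conv_hull R n (simplex s `|` reflection u @` simplex s).
  apply => //; first by rewrite divr_ge0 // ltW.
  by rewrite ler_pdivrMr // mul1r.
rewrite /reflection scalerBr scalerA divfK ?gt_eqF // addrA -scalerDl.
by rewrite subrK scale1r.
Qed.

(** When the slope at i is negative: the time at which a point rising from y
    with velocity u crosses the hyperplane of the i-th facet. *)
Definition exit_time i y := bary i y / - a i.

(** The j-th barycentric coordinate of the crossing point. *)
Definition exit_bary i j y := bary j y + exit_time i y * a j.

(** The segment below a point with barycentric coordinates z_j has length
    2 * \sum_j z_j * h j, the total length of consecutive layers, one for each
    vertex; this is the depth at which the k-th layer begins. *)
Definition stack i k y := 2 * \sum_(j : 'I_n.+1 | (j < k)%N) exit_bary i j y * h j.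

Lemma affine_form_exit_time i : affine_form (exit_time i).
Proof.
have [c [e E]] := affine_formZ (- a i)^-1 (aff i).
by exists c, e => y; rewrite -E mulrC.
Qed.

Lemma affine_form_exit_bary i j : affine_form (exit_bary i j).
Proof.
apply: affine_formD => //.
have [c [e E]] := affine_formZ (a j) (affine_form_exit_time i).
by exists c, e => y; rewrite -E mulrC.
Qed.

Lemma affine_form_stack i k : affine_form (stack i k).
Proof.
apply: affine_formZ; apply: affine_form_sum => j.
have [c [e E]] := affine_formZ (h j) (affine_form_exit_bary i j).
by exists c, e => y; rewrite -E mulrC.
Qed.

Lemma exit_bary_shift i j y t : a i < 0 ->
  exit_bary i j (y + t *: u) = exit_bary i j y.
Proof.
by move=> ai; rewrite /exit_bary /exit_time !bary_shift; field; rewrite lt_eqF.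
Qed.

Lemma exit_time_shift i y t : a i < 0 ->
  exit_time i (y + t *: u) = exit_time i y - t.
Proof.
by move=> ai; rewrite /exit_time !bary_shift; field; rewrite lt_eqF.
Qed.

Lemma stack_shift i k y t : a i < 0 -> stack i k (y + t *: u) = stack i k y.
Proof.
move=> ai; rewrite /stack; congr (2 * _).
by apply: eq_bigr => j _; rewrite exit_bary_shift.
Qed.

Lemma exit_baryE i y : exit_bary i ^~ y =1 bary ^~ (y + exit_time i y *: u).
Proof. by move=> j; rewrite bary_shift. Qed.

Lemma exit_bary_self i y : a i < 0 -> exit_bary i i y = 0.
Proof. by move=> ai; rewrite /exit_bary /exit_time; field; rewrite lt_eqF. Qed.

(** Adding c * - slope i times this vector, which amounts to c *: u plus
    (c / (2 * h k)) *: (s i - s k), moves the point at depth c below the i-th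
    facet up to the facet, and then in the direction from s k to s i. *)
Definition tilt i k : 'rV[R]_n :=
  (- a i)^-1 *: (u + (2 * h k)^-1 *: (s i - s k)).

(** The first factor shears the k-th layer vertically until it starts at the
    facet; the second one carries the sheared layer, a simplex with the vertices
    of the i-th facet and s k - (2 * h k) *: u, onto the given simplex, the last
    vertex going to s i. *)
Definition piece_map i k y :=
  rank_one (bary i) (tilt i k) (rank_one (stack i k) u y).

Definition piece i k : set 'rV[R]_n := piece_map i k @^-1` simplex s.

(** The i-th facet faces upwards, s k belongs to it and has positive height;
    these are the layers that are not flat. *)
Definition upper_pair i k := [&& a i < 0, k != i & k != ord0].

Lemma bary_tilt i j k : bary j (tilt i k) - bary j 0 =
  (- a i)^-1 * (a j + (2 * h k)^-1 * ((j == i)%:R - (j == k)%:R)).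
Proof.
have [c [e E]] := aff j.
rewrite -!(bary_vertex s_indep) /slope !E /tilt dotZr dotDr dotZr dotBr dot0r.
ring.
Qed.

Lemma bary_piece_map i j k y : upper_pair i k ->
  bary j (piece_map i k y) = exit_bary i j y +
  (exit_time i y - stack i k y) / (2 * h k) * ((j == i)%:R - (j == k)%:R).
Proof.
move=> /and3P[ai ki k0]; rewrite /piece_map {1}/rank_one affine_form_shift //.
rewrite bary_tilt /rank_one !bary_shift /exit_bary /exit_time.
by field; rewrite (lt_eqF ai) (gt_eqF (s_above k0)).
Qed.

Lemma pieceP i k y : upper_pair i k -> piece i k y <->
  [/\ forall j, 0 <= exit_bary i j y, stack i k y <= exit_time i y
    & exit_time i y <= stack i k y + 2 * (exit_bary i k y * h k)].
Proof.
move=> ik; have /and3P[ai ki k0] := ik; have hk := s_above k0.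
have h2 : 0 < 2 * h k by rewrite mulr_gt0.
rewrite /piece /= simplexE //=; set c := (exit_time i y - stack i k y) / (2 * h k).
have cE : exit_time i y - stack i k y = c * (2 * h k) by rewrite divfK // gt_eqF.
have Ek : bary k (piece_map i k y) = exit_bary i k y - c.
  by rewrite bary_piece_map // (negPf ki) eqxx -/c /=; ring.
have Ei : bary i (piece_map i k y) = c.
  by rewrite bary_piece_map // exit_bary_self // eqxx [i == k]eq_sym (negPf ki) -/c /=; ring.
have Ej j : j != i -> j != k -> bary j (piece_map i k y) = exit_bary i j y.
  by move=> /negPf ji /negPf jk; rewrite bary_piece_map // ji jk /=; ring.
have top : exit_time i y <= stack i k y + 2 * (exit_bary i k y * h k) <->
    c <= exit_bary i k y.
  rewrite -[c <= _](ler_pM2r h2) -cE; split; lra.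
have bot : stack i k y <= exit_time i y <-> 0 <= c.
  by rewrite -subr_ge0 cE pmulr_lge0.
split => [S0|[z0 /bot c0 /top ck] j].
  have c0 : 0 <= c by rewrite -Ei.
  have kc : c <= exit_bary i k y by rewrite -subr_ge0 -Ek.
  split; [|exact/bot|exact/top] => j.
  have [->|ji] := eqVneq j i; first by rewrite exit_bary_self.
  have [->|jk] := eqVneq j k; first exact: le_trans kc.
  by rewrite -Ej.
have [->|ji] := eqVneq j i; first by rewrite Ei.
have [->|jk] := eqVneq j k; first by rewrite Ek subr_ge0.
by rewrite Ej.
Qed.

Lemma borel_piece i k : borel (piece i k).
Proof.
have bS := borel_rank_one (tilt i k) (aff i) (borel_simplex s_indep).
exact: (borel_rank_one u (affine_form_stack i k) bS).
Qed.

(** The shear preserves volumes because the depth at which a layer begins is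
    constant along vertical lines; all of the ratio comes from the tilt. *)
Lemma volume_piece i k : upper_pair i k ->
  volume (piece i k) = ((2 * h k * - a i)%:E * volume (simplex s))%E.
Proof.
move=> /and3P[ai ki k0]; have hk := s_above k0.
have bS := borel_simplex s_indep.
have E1 : 1 + (stack i k u - stack i k 0) = 1.
  by rewrite -[u]scale1r -[1 *: u]add0r stack_shift // subrr addr0.
have E2 : 1 + (bary i (tilt i k) - bary i 0) = (2 * h k * - a i)^-1.
  rewrite bary_tilt eqxx [i == k]eq_sym (negPf ki).
  by rewrite /=; field; rewrite (lt_eqF ai) (gt_eqF hk).
have r0 : 0 < 2 * h k * - a i by rewrite !mulr_gt0 // oppr_gt0.
have bS' := borel_rank_one (tilt i k) (aff i) bS.
have := volume_rank_one (w := u) (affine_form_stack i k) _ bS'.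
rewrite E1 oner_eq0 normr1 mul1e => /(_ isT) V1.
have := volume_rank_one (w := tilt i k) (aff i) _ bS.
rewrite E2 gt_eqF ?invr_gt0 // gtr0_norm ?invr_gt0 // => /(_ isT) <-.
by rewrite -V1 muleA -EFinM mulfV ?gt_eqF // mul1e.
Qed.

Lemma piece_sub i k y : upper_pair i k -> piece i k y -> double_prism y.
Proof.
move=> ik /(pieceP _ ik)[z0 bot top]; have /and3P[ai ki k0] := ik.
have zh0 j : 0 <= exit_bary i j y * h j by rewrite mulr_ge0 ?vertex_height_ge0.
exists (y + exit_time i y *: u), (exit_time i y); split.
- by rewrite simplexE // => j; rewrite -exit_baryE.
- by apply: le_trans bot; rewrite mulr_ge0 // sumr_ge0.
- apply: le_trans top _; rewrite -mulrDr ler_pM2l // (dot_bary s_indep u (y + _)).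
  under [leRHS]eq_bigr do rewrite -exit_baryE.
  rewrite [leRHS](bigID (fun j : 'I_n.+1 => (j < k)%N)) /= lerD2l (bigD1 k) ?ltnn //=.
  by rewrite lerDl sumr_ge0.
- by rewrite addrK.
Qed.

(** V marks the layers that may be chosen. It can hold where g vanishes, so that
    a layer is found even when t and all the thicknesses are 0. *)
Lemma layer_exists (V : pred 'I_n.+1) (g : 'I_n.+1 -> R) (m : nat) (t : R) :
  (m <= n.+1)%N -> (forall j, 0 <= g j) -> (forall j, g j != 0 -> V j) -> 0 <= t ->
  t <= \sum_(j : 'I_n.+1 | (j < m)%N) g j -> (exists2 j : 'I_n.+1, (j < m)%N & V j) ->
  exists k, [/\ V k, \sum_(j : 'I_n.+1 | (j < k)%N) g j <= t
    & t <= \sum_(j : 'I_n.+1 | (j < k)%N) g j + g k].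
Proof.
move=> + g0 gV t0; elim: m => [_ _ [j]|m IH mn]; first by rewrite ltn0.
pose m' := Ordinal mn.
have split_m : \sum_(j : 'I_n.+1 | (j < m.+1)%N) g j =
    \sum_(j : 'I_n.+1 | (j < m)%N) g j + g m'.
  rewrite (bigD1 m') //= addrC; congr (_ + _); apply: eq_bigl => j.
  by rewrite ltnS -val_eqE /= ltn_neqAle andbC.
rewrite split_m => tm [j jm Vj].
have [tlt|tge] := ltP t (\sum_(j : 'I_n.+1 | (j < m)%N) g j).
  apply: IH; [exact: ltnW|exact: ltW|].
  have : \sum_(j : 'I_n.+1 | (j < m)%N) g j != 0 by rewrite gt_eqF // (le_lt_trans t0).
  rewrite psumr_neq0 // => /hasP[l _ /andP[lm gl]].
  by exists l => //; apply: gV; rewrite gt_eqF.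
have [Vm|Vm] := boolP (V m'); first by exists m'.
have gm : g m' = 0 by apply/eqP; apply: contraNT Vm; exact: gV.
apply: IH; [exact: ltnW|by rewrite gm addr0 in tm|exists j => //].
move: jm; rewrite ltnS leq_eqVlt => /predU1P[jm|//].
by move: Vm; rewrite -(_ : j = m') ?Vj //; exact: val_inj.
Qed.

(** A point rising from y traverses the simplex and leaves it through the facet
    whose exit time is least among the facets of negative slope; y then lies in
    one of the layers hanging from that facet. *)
Lemma double_prism_sub y : double_prism y -> exists i k, upper_pair i k /\ piece i k y.
Proof.
move=> [z0 [t0 [Sz0 t00 t0z yE]]].
have z0E : z0 = y + t0 *: u by rewrite yE subrK.
(* A vertex of positive height and slope; it lies on every upper facet. *)
have [k ak] : exists k, 0 < a k * h k.
  apply: contrapT => /forallNP ah.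
  have := sum_slope_height; apply/eqP; rewrite lt_eqF // (le_lt_trans _ ltr01) //.
  by apply: sumr_le0 => j _; rewrite leNgt; apply/negP.
have [k0 ak0] : k != ord0 /\ 0 < a k.
  have k0 : k != ord0.
    by apply: contraTneq ak => ->; rewrite s_0 dot0r mulr0 ltxx.
  by move: ak; rewrite pmulr_lgt0 // s_above.
have [i0 ai0] : exists i, a i < 0.
  apply: contrapT => /forallNP ap.
  have ap' j : 0 <= a j by rewrite leNgt; apply/negP.
  have := sum_slope; apply/eqP; rewrite gt_eqF // (bigD1 k) //=.
  by rewrite ltr_wpDr // sumr_ge0.
have [i ai imin] := @arg_minP _ _ _ i0 (fun i => a i < 0) (exit_time^~ y) ai0.
have Sz0' j : 0 <= bary j y + t0 * a j.
  by move: Sz0; rewrite simplexE //= => /(_ j); rewrite z0E bary_shift.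
have t0i : t0 <= exit_time i y.
  by rewrite /exit_time ler_pdivlMr ?oppr_gt0 //; have := Sz0' i; lra.
have zi0 j : 0 <= exit_bary i j y.
  rewrite /exit_bary; have [aj|aj] := ltP (a j) 0.
    have := imin _ aj; rewrite {2}/exit_time ler_pdivlMr ?oppr_gt0 //; lra.
  apply: le_trans (Sz0' j) _; rewrite lerD2l ler_wpM2r //.
pose g j := 2 * (exit_bary i j y * h j).
have g0 j : 0 <= g j by rewrite !mulr_ge0 ?vertex_height_ge0.
have stackE j : stack i j y = \sum_(l : 'I_n.+1 | (l < j)%N) g l.
  by rewrite /stack mulr_sumr.
have [k' []] : exists k, [/\ (k != i) && (k != ord0), stack i k y <= exit_time i y &
    exit_time i y <= stack i k y + g k].
  have := @layer_exists (fun k => (k != i) && (k != ord0)) g n.+1 (exit_time i y).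
  case=> //.
  - move=> j gj; apply/andP; split; apply: contraNneq gj => ->.
      by rewrite /g exit_bary_self // mul0r mulr0.
    by rewrite /g s_0 dot0r !mulr0.
  - exact: le_trans t0i.
  - have -> : \sum_(j : 'I_n.+1 | (j < n.+1)%N) g j = 2 * dot u (y + exit_time i y *: u).
      rewrite (dot_bary s_indep u) mulr_sumr; apply: eq_big => [j|j _]; first exact: ltn_ord.
      by rewrite -exit_baryE.
    move: t0z; rewrite z0E !dotDr !dotZr u_unit !mulr1; lra.
  - exists k; first exact: ltn_ord.
    by rewrite k0 andbT; apply: contraTneq ak0 => ->; rewrite -leNgt ltW.
  by move=> l; rewrite -stackE; exists l.
move=> /andP[ki k'0] bot top.
have ik : upper_pair i k' by apply/and3P.
by exists i, k'; split => //; apply/pieceP.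
Qed.

Lemma double_prismE :
  double_prism = [set y | exists2 p, upper_pair p.1 p.2 & piece p.1 p.2 y].
Proof.
apply/seteqP; split => [y /double_prism_sub[i [k [ik ky]]]|y [[i k] ik]].
  by exists (i, k).
exact: piece_sub.
Qed.

Lemma exit_time_le i i' k y : upper_pair i k -> a i' < 0 -> piece i k y ->
  exit_time i y <= exit_time i' y.
Proof.
move=> ik ai' /(pieceP _ ik)[z0 _ _]; rewrite {2}/exit_time ler_pdivlMr ?oppr_gt0 //.
by have := z0 i'; rewrite /exit_bary; lra.
Qed.

Lemma stack_le i k k' y : (k < k')%N -> upper_pair i k -> piece i k y ->
  exit_time i y <= stack i k' y.
Proof.
move=> kk' ik /(pieceP _ ik)[z0 _ /le_trans]; apply.
rewrite /stack -mulrDr ler_pM2l // [leRHS](bigID (fun j : 'I_n.+1 => (j < k)%N)) /=.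
have -> : \sum_(j : 'I_n.+1 | (j < k')%N && (j < k)%N) exit_bary i j y * h j =
    \sum_(j : 'I_n.+1 | (j < k)%N) exit_bary i j y * h j.
  apply: eq_bigl => j; case: (ltnP j k) => [jk|]; last by rewrite andbF.
  by rewrite andbT (ltn_trans jk).
rewrite lerD2l (bigD1 k) /=; last by rewrite kk' ltnn.
by rewrite lerDl sumr_ge0 // => j _; rewrite mulr_ge0 ?vertex_height_ge0.
Qed.

(** Below two different facets the exit times agree on the overlap; below the
    same facet, the overlap lies in the hyperplane where the later layer
    begins. *)
Lemma volume_pieceI p q : upper_pair p.1 p.2 -> upper_pair q.1 q.2 -> p != q ->
  volume (piece p.1 p.2 `&` piece q.1 q.2) = 0%E.
Proof.
move: p q => [i k] [i' k'] /= ik ik' pq.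
have ai : a i < 0 by case/and3P: ik.
have ai' : a i' < 0 by case/and3P: ik'.
have bI : borel (piece i k `&` piece i' k').
  by apply: measurableI; exact: borel_piece.
have fin : (volume (piece i k `&` piece i' k') < +oo)%E.
  apply: (@le_lt_trans _ _ (volume (piece i k))).
    by apply: le_volume => //; exact: borel_piece.
  rewrite volume_piece // lte_mul_pinfty ?volume_simplex_lty // lee_fin.
  by rewrite !mulr_ge0 ?vertex_height_ge0 // oppr_ge0 ltW.
have [ii'|ii'] := eqVneq i i'.
  rewrite -{i' ik' ai'}ii' in ik' pq bI fin *.
  have kk' : k != k' by apply: contraNneq pq => ->.
  wlog lt_kk' : k k' ik ik' {pq} kk' bI fin / (k < k')%N.
    move=> W; move: (kk'); rewrite -val_eqE neq_ltn => /orP[lt|lt]; first exact: W.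
    by rewrite setIC; apply: W => //; rewrite 1?eq_sym // setIC.
  have aphi : affine_form (fun y => exit_time i y - stack i k' y).
    exact: affine_formB (affine_form_exit_time i) (affine_form_stack i k').
  apply: (volume_hyperplane (v := u) aphi) => //.
    rewrite -[u]scale1r -[1 *: u]add0r exit_time_shift // stack_shift //.
    by rewrite -subr_eq0; apply/eqP; lra.
  move=> y [py py'] /=; apply/eqP; rewrite subr_eq0 eq_le.
  by rewrite (stack_le lt_kk' ik py); case/(pieceP _ ik'): py' => _ ->.
have aphi : affine_form (fun y => exit_time i y - exit_time i' y).
  exact: affine_formB (affine_form_exit_time i) (affine_form_exit_time i').
apply: (volume_hyperplane (v := s i - s i') aphi) => //.
  have st j : exit_time j (s i - s i') =
      exit_time j 0 + ((j == i)%:R - (j == i')%:R) / - a j.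
    rewrite /exit_time -mulrDl; congr (_ / _); have [c [e E]] := aff j.
    by rewrite -!(bary_vertex s_indep) !E dotBr dot0r; ring.
  rewrite !st !eqxx [i' == i]eq_sym (negPf ii') /= -subr_eq0.
  rewrite (_ : _ - _ = (- a i)^-1 + (- a i')^-1).
    by rewrite gt_eqF // addr_gt0 // invr_gt0 oppr_gt0.
  by ring.
move=> y [py py'] /=; apply/eqP; rewrite subr_eq0 eq_le.
by rewrite (exit_time_le ik ai' py) (exit_time_le ik' ai py').
Qed.

Lemma volume_double_prism :
  volume double_prism = ((\sum_(i | a i < 0)
    2 * - a i * \sum_(k | k != i) h k)%:E * volume (simplex s))%E.
Proof.
rewrite double_prismE.
rewrite (volume_bigcup_almost_disjoint (D := fun p => piece p.1 p.2)
  (P := fun p => upper_pair p.1 p.2)); last 2 first.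
- by move=> p _; exact: borel_piece.
- exact: volume_pieceI.
under eq_bigr do rewrite volume_piece //.
rewrite -ge0_sume_distrl; last first.
  move=> p /and3P[ai _ _].
  by rewrite lee_fin !mulr_ge0 ?vertex_height_ge0 // oppr_ge0 ltW.
rewrite sumEFin; congr (_%:E * _)%E.
rewrite -(pair_big_dep (fun i => a i < 0) (fun i k => (k != i) && (k != ord0))
  (fun i k => 2 * h k * - a i)) /=.
apply: eq_bigr => i _; rewrite mulr_sumr [RHS](bigID (fun k => k != ord0)) /=.
rewrite [X in _ = _ + X]big1 ?addr0; last first.
  by move=> k /andP[_ /negbNE/eqP ->]; rewrite s_0 dot0r mulr0.
by apply: eq_bigr => k _; ring.
Qed.

End double_prism.

(** * Facets of the upper side and their normals *)

Section upper_facets.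
Variables (R : realType) (n : nat) (s : 'I_n.+1 -> 'rV[R]_n).
Hypothesis s_indep : affinely_independent s.
Implicit Types (u v w x y p : 'rV[R]_n).

Lemma affine_hull_facet i p : affine_hull (facet s i) p -> bary s i p = 0.
Proof.
have aff := affine_form_bary s i.
apply: (@smallest_sub _ _ _ (fun x => bary s i x = 0)); last first.
  by move=> x; rewrite facetE // => -[].
by move=> x y t x0 y0; rewrite (affine_form_convex _ _ _ aff) x0 y0 !mulr0 addr0.
Qed.

Lemma vertex_facet (i j : 'I_n.+1) : j != i -> facet s i (s j).
Proof. by move=> ji; apply: sub_conv_hull; exists j => //=. Qed.

Lemma affine_hull_line i x y (t : R) : affine_hull (facet s i) x ->
  affine_hull (facet s i) y -> affine_hull (facet s i) ((1 - t) *: x + t *: y).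
Proof. by move=> Hx Hy C [cC FC]; exact: cC (Hx C (conj cC FC)) (Hy C (conj cC FC)). Qed.

(** If a further coordinate, the j-th, vanishes at p, then moving p slightly
    away from s j inside the affine hull of the facet makes it negative. *)
Lemma relint_facetP i p : relint (facet s i) p <->
  bary s i p = 0 /\ (forall j, j != i -> 0 < bary s j p).
Proof.
rewrite /relint /= {1}facetE //; split => [[[p0 pi] near_p]|[pi p0]].
  split => // j ji; rewrite lt_neqAle p0 andbT; apply/eqP => /esym pj.
  have fp : facet s i p by rewrite facetE.
  pose q (t : R) := p + t *: (p - s j).
  have q0 : q 0 = p by rewrite /q scale0r addr0.
  have qc : q @ (0 : R) --> q 0.
    by apply: cvgD; [exact: cvg_cst|apply: cvgZr_tmp; exact: cvg_id].
  have near_q : nbhs (q 0) [set x | affine_hull (facet s i) x -> facet s i x].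
    by rewrite q0.
  have : \forall t \near (0 : R), affine_hull (facet s i) (q t) -> facet s i (q t).
    exact: qc near_q.
  move=> /nbhs_ballP[e /= e0 He].
  have := He (e / 2); rewrite /ball /= sub0r normrN gtr0_norm ?divr_gt0 //.
  rewrite ltr_pdivrMr // ltr_pMr // ltr1n => /(_ isT).
  have -> : q (e / 2) = (1 - (- (e / 2))) *: p + (- (e / 2)) *: s j.
    by rewrite /q opprK scalerDl scale1r scaleNr scalerBr addrA.
  have hp : affine_hull (facet s i) p by move=> C [_]; exact.
  have hs : affine_hull (facet s i) (s j) by move=> C [_]; apply; exact: vertex_facet.
  move=> /(_ (affine_hull_line _ hp hs)); rewrite facetE //= => -[/(_ j) + _].
  rewrite (affine_form_convex _ _ _ (affine_form_bary s j)) pj bary_vertex // eqxx.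
  by rewrite mulr0 add0r mulr1 oppr_ge0 leNgt divr_gt0.
split.
  by split => // j; have [->|/p0/ltW //] := eqVneq j i; rewrite pi.
have : \forall x \near p, forall j, j != i -> 0 < bary s j x.
  apply: (@filter_forall _ _ _ (nbhs (p : 'rV[R]_n)) _) => j.
  have [->|ji] := eqVneq j i; first by apply: (@nearW _ (nbhs (p : 'rV[R]_n))) => x.
  have cont : continuous (bary s j) by exact: affine_form_continuous (affine_form_bary s j).
  have : \forall x \near nbhs (p : 'rV[R]_n), 0 < bary s j x.
    exact: (cont p _ (lt_nbhsr (p0 j ji))).
  by apply: (@filterS _ (nbhs (p : 'rV[R]_n))) => x.
apply: (@filterS _ (nbhs (p : 'rV[R]_n))) => x x0 /affine_hull_facet xi.
rewrite facetE //=; split => // j.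
by have [->|/x0/ltW //] := eqVneq j i; rewrite xi.
Qed.

Lemma small_step (I : finType) (b c : I -> R) :
  (forall j, 0 < b j \/ b j = 0 /\ 0 <= c j) ->
  exists2 t, 0 < t & forall j, 0 <= b j + t * c j.
Proof.
move=> bc.
have : \forall t \near (0 : R)^'+, forall j, 0 <= b j + t * c j.
  apply: filter_forall => j.
  have ct : 0 < 1 + `|c j| by rewrite ltr_pwDl.
  have [bj|[-> cj]] := bc j; near=> t; last by rewrite add0r mulr_ge0.
  have tc : t * `|c j| <= b j.
    have : t <= b j / (1 + `|c j|).
      by near: t; apply: nbhs_right_le; rewrite divr_gt0.
    by rewrite ler_pdivlMr //; apply: le_trans; rewrite ler_pM2l // lerDr.
  have := ler_norm (- (t * c j)); rewrite normrN normrM gtr0_norm //.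
  by move: tc; clear; lra.
move=> near_t.
have : \forall t \near (0:R)^'+, 0 < t /\ forall j, 0 <= b j + t * c j.
  near=> t; split => //; near: t; exact: near_t.
by case/filter_ex => t [t0 tbc]; exists t.
Unshelve. all: by end_near. Qed.

(** If the slope is not negative, a point in the relative interior of the facet
    can rise a little inside the simplex. If it is negative, no point of the
    facet can, and the centroid of the facet is a witness. *)
Lemma upper_side_facet i u : n != 0%N ->
  (facet s i \in upper_side s u) = (slope s u i < 0).
Proof.
move=> n0; apply/idP/idP; rewrite inE.
  move=> [i' [_ [p [/relint_facetP[pi p0] [Sp out]]]]].
  rewrite ltNge; apply/negP => ai.
  have [t t0 tbc] : exists2 t, 0 < t & forall j, 0 <= bary s j p + t * slope s u j.
    apply: small_step => j; have [->|ji] := eqVneq j i; first by right.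
    by left; exact: p0.
  apply: (out _ t0); rewrite simplexE //= => j.
  by rewrite (affine_form_shift _ _ _ (affine_form_bary s j)) tbc.
move=> ai; exists i; split => //.
pose p := n%:R^-1 *: \sum_(k | k != i) s k.
have nR : n%:R != 0 :> R by rewrite pnatr_eq0.
have card_i : \sum_(k < n.+1 | k != i) 1 = n%:R :> R.
  have := @sumr_const R 'I_n.+1 predT 1; rewrite card_ord (bigD1 i) //= => /eqP.
  by rewrite -natr1 addrC => /eqP/addIr.
have bp j : bary s j p = (j != i)%:R / n%:R.
  have [c [e E]] := affine_form_bary s j.
  rewrite E /p dotZr dot_sumr.
  under eq_bigr => k _ do rewrite -[dot c (s k)](addrK e) -E bary_vertex //.
  rewrite sumrB (_ : \sum_(k < n.+1 | k != i) e = n%:R * e); last first.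
    by rewrite -card_i mulr_suml; apply: eq_bigr => k _; rewrite mul1r.
  rewrite mulrBr mulrA mulVf // mul1r subrK mulrC; congr (_ / _).
  have [->|ji] := eqVneq j i; last first.
    rewrite (bigD1 j) //= eqxx big1 ?addr0 // => k /andP[_].
    by rewrite eq_sym => /negPf ->.
  by rewrite big1 // => k; rewrite eq_sym => /negPf ->.
exists p; split.
  apply/relint_facetP; split; first by rewrite bp eqxx mul0r.
  by move=> j ji; rewrite bp ji divr_gt0 // ltr0n lt0n.
split.
  by rewrite simplexE //= => j; rewrite bp divr_ge0.
move=> t t0; rewrite simplexE //= => /(_ i).
rewrite (affine_form_shift _ _ _ (affine_form_bary s i)) bp eqxx mul0r add0r.
by rewrite pmulr_rge0 // leNgt ai.
Qed.

(** A linear form constant on the facet is a multiple of the linear part of the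
    i-th barycentric coordinate; d is the distance from s i to the facet. *)
Lemma normal_slope i v : outward_unit_normal (simplex s) (facet s i) v ->
  n != 0%N ->
  exists2 d, 0 < d & forall w, dot v w = - (bary s i w - bary s i 0) * d.
Proof.
move=> [v1 vF vS] n0.
have [k ki] : exists k, k != i.
  have [->|i0] := eqVneq i ord0; last by exists ord0; rewrite eq_sym.
  have n_gt0 : (0 < n)%N by rewrite lt0n.
  by exists (lift ord0 (Ordinal n_gt0)).
have E w : dot v w = - (bary s i w - bary s i 0) * dot v (s k - s i).
  have -> : dot v w = \sum_j (bary s j w - bary s j 0) * dot v (s j).
    rewrite -[LHS]subr0 -[X in _ - X](dot0r v) !(dot_bary s_indep v) -sumrB.
    by apply: eq_bigr => j _; rewrite mulrBl.
  have sum0 : \sum_j (bary s j w - bary s j 0) * dot v (s k) = 0.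
    by rewrite -mulr_suml sumrB !sum_bary // subrr mul0r.
  rewrite -[LHS]subr0 -[X in _ - X]sum0 -sumrB (bigD1 i) //= big1 ?addr0 => [|j ji].
    by rewrite dotBr; ring.
  rewrite -mulrBr -dotBr vF ?mulr0 //; exact: vertex_facet.
exists (dot v (s k - s i)) => //.
have d0 : 0 <= dot v (s k - s i).
  have Ssi : simplex s (s i) by apply: sub_conv_hull; exists i.
  by have := vS _ _ Ssi (vertex_facet ki); rewrite !dotBr; lra.
rewrite lt_neqAle d0 andbT; apply/eqP => d_eq0.
by move: v1; rewrite E -d_eq0 mulr0 => /esym/eqP; rewrite oner_eq0.
Qed.

End upper_facets.

Theorem mainTheorem2 (R : realType) (n : nat)
    (s : 'I_n.+1 -> 'rV[R]_n) (u : 'rV[R]_n) (normal : 'I_n.+1 -> 'rV[R]_n)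
    (s_indep : affinely_independent s)
    (s_0 : s ord0 = 0)
    (u_unit : dot u u = 1)
    (s_above : forall i, i != ord0 -> 0 < dot u (s i))
    (normalP : forall i,
       outward_unit_normal (simplex s) (facet s i) (normal i)) :
  let S := simplex s in
  let SH := reflection u @` S in
  let sigma := \sum_i s i in
  ((volume S)^-1 * volume (conv_hull (S `|` SH)))%E =
  (2 * n%:R *
   \sum_(i | facet s i \in upper_side s u)
     dot (normal i) u * dot u (sigma - s i) /
     `|dot (normal i) (n.+1%:R *: s i - sigma)|)%:E.
Proof.
move=> S SH sigma.
have n0 : n != 0%N.
  apply/eqP => n0; subst n; move/esym/eqP: u_unit.
  by rewrite (thinmx0 u) dot0l oner_eq0.
have [d d0 dE] : exists2 d : 'I_n.+1 -> R, (forall i, 0 < d i) & forall i w,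
    dot (normal i) w = - (bary s i w - bary s i 0) * d i.
  have /choice[d dP] : forall i, exists d, 0 < d /\ forall w,
      dot (normal i) w = - (bary s i w - bary s i 0) * d.
    by move=> i; have [d d0 dE] := normal_slope s_indep (normalP i) n0; exists d.
  by exists d => i; have [] := dP i.
rewrite /S /SH conv_hull_reflection // volume_double_prism //.
have V0 := volume_simplex_gt0 s_indep; have Voo := volume_simplex_lty s_indep.
rewrite muleC -muleA -[X in _ = X]mule1; congr (_ * _)%E; last first.
  have Vfin : volume (simplex s) \is a fin_num by rewrite ge0_fin_numE // ltW.
  move: V0; rewrite -(fineK Vfin) lte_fin => V0.
  by rewrite inver gt_eqF // -EFinM mulfV // gt_eqF.
congr (_%:E); rewrite mulr_sumr; apply: eq_big => [i|i ai].
  by rewrite upper_side_facet.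
rewrite -/(slope s u i) in ai *.
have nR : 0 < n%:R :> R by rewrite ltr0n lt0n.
have -> : dot u (sigma - s i) = \sum_(k | k != i) dot u (s k).
  by rewrite /sigma (bigD1 i) //= addrAC subrr add0r dot_sumr.
have -> : dot (normal i) (n.+1%:R *: s i - sigma) = - (n%:R * d i).
  rewrite dE mulNr; congr (- (_ * _)); have [c [e E]] := affine_form_bary s i.
  rewrite !E dot0r dotBr dotZr /sigma dot_sumr.
  under eq_bigr => k _ do rewrite -[dot c (s k)](addrK e) -E bary_vertex //.
  rewrite sumrB sumr_const card_ord (bigD1 i) //= eqxx big1 => [|k ki]; last first.
    by rewrite eq_sym (negPf ki).
  have := bary_vertex s_indep i i; rewrite E eqxx -[e *+ _]mulr_natl -natr1 /= => Ei.
  rewrite (_ : dot c (s i) = 1 - e); last by rewrite -[1](_ : true%:R = 1) // -Ei addrK.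
  by ring.
rewrite normrN gtr0_norm ?mulr_gt0 // dE -/(slope s u i).
by field; rewrite !gt_eqF.
Qed.
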